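(* Let $n, r$ be integers with $2<r<n$, let $\mathrm{ESP}_r\in\mathbb{C}[X_1,\ldots,X_n]$ be the $r$-th elementary symmetric polynomial, and let $H_r=\{h\in\mathrm{GL}_n(\mathbb{C}) : \mathrm{ESP}_r\circ h=\mathrm{ESP}_r\}$ be its stabilizer. Then $H_r\cong \mathfrak{S}_n\rtimes \mathbb{Z}_r$, where $\mathfrak{S}_n$ corresponds to the subgroup of $n\times n$ permutation matrices and $\mathbb{Z}_r=\{\omega\in\mathbb{C} : \omega^r=1\}$ corresponds to the subgroup of scalar matrices $\omega\cdot I_n$ with $\omega^r=1$. That is, $H_r$ consists exactly of the matrices $\omega P$ with $P$ a permutation matrix and $\omega^r=1$, and each element of $H_r$ has a unique such expression.
   Context: The $r$-th elementary symmetric polynomial in $n$ variables is $\mathrm{ESP}_r(X_1,\ldots,X_n)=\sum_{I\subseteq\{1,\ldots,n\},\,|I|=r}\prod_{i\in I}X_i$. It is regarded as a polynomial function on $\mathbb{C}^n$, and for $h\in\mathrm{GL}_n(\mathbb{C})$ the polynomial $\mathrm{ESP}_r\circ h$ is obtained by precomposing with the linear map $h:\mathbb{C}^n\to\mathbb{C}^n$. *)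

(* Defs.v *)
From HB Require Import structures.
From mathcomp Require Import all_boot all_order all_algebra all_fingroup.
From mathcomp Require Import reals complex mpoly.

Set Implicit Arguments.
Unset Strict Implicit.
Unset Printing Implicit Defensive.

Import GRing.Theory.
Local Open Scope ring_scope.

Section GeneralLinear.
Variables (K : comUnitRingType) (n : nat).

(* The library's {'GL_n[R]} requires R to be finite. *)
Record GLmx := MkGLmx { mxGL :> 'M[K]_n; mxGL_unit : mxGL \in unitmx }.
HB.instance Definition _ := [isSub for mxGL].
HB.instance Definition _ := [Choice of GLmx by <:].

Definition GLmx_one := MkGLmx (unitmx1 K n).

Fact GLmx_mul_unit (g h : GLmx) : g *m h \in unitmx.
Proof. by rewrite unitmx_mul !mxGL_unit. Qed.
Definition GLmx_mul (g h : GLmx) := MkGLmx (GLmx_mul_unit g h).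

Fact GLmx_inv_unit (g : GLmx) : invmx g \in unitmx.
Proof. by rewrite unitmx_inv mxGL_unit. Qed.
Definition GLmx_inv (g : GLmx) := MkGLmx (GLmx_inv_unit g).

Fact GLmx_mulA : associative GLmx_mul.
Proof. by move=> f g h; apply/val_inj/mulmxA. Qed.
Fact GLmx_mul1 : left_id GLmx_one GLmx_mul.
Proof. by move=> g; apply/val_inj/mul1mx. Qed.
Fact GLmx_1mul : right_id GLmx_one GLmx_mul.
Proof. by move=> g; apply/val_inj/mulmx1. Qed.
Fact GLmx_mulV : left_inverse GLmx_one GLmx_inv GLmx_mul.
Proof. by move=> g; apply/val_inj/mulVmx/mxGL_unit. Qed.
Fact GLmx_Vmul : right_inverse GLmx_one GLmx_inv GLmx_mul.
Proof. by move=> g; apply/val_inj/mulmxV/mxGL_unit. Qed.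

HB.instance Definition _ := isGroup.Build GLmx
  GLmx_mulA GLmx_mul1 GLmx_1mul GLmx_mulV GLmx_Vmul.

End GeneralLinear.

Section Precomposition.
Variables (K : comUnitRingType) (n : nat).

Definition precomp (p : {mpoly K[n]}) (A : 'M[K]_n) : {mpoly K[n]} :=
  p \mPo [tuple \sum_(j < n) A i j *: 'X_j | i < n].

Lemma meval_precomp p A (x : 'cV[K]_n) :
  (precomp p A).@[fun i => x i 0] = p.@[fun i => (A *m x) i 0].
Proof.
rewrite comp_mpoly_meval; apply: meval_eq => i.
rewrite tnth_mktuple mxE raddf_sum; apply: eq_bigr => j _ /=.
by rewrite mevalZ mevalXU.
Qed.

Lemma precomp1 p : precomp p 1%:M = p.
Proof.
rewrite -[RHS]comp_mpoly_id; congr (_ \mPo _); apply: eq_from_tnth => i.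
rewrite !tnth_mktuple (bigD1 i) //= mxE eqxx scale1r big1 ?addr0 // => j ji.
by rewrite mxE eq_sym (negPf ji) scale0r.
Qed.

Lemma precompM p A B : precomp p (A *m B) = precomp (precomp p A) B.
Proof.
elim/mpolyind: p => [|c m p _ _ IH]; first by rewrite /precomp !raddf0.
rewrite /precomp !raddfD /= -!/(precomp _ _) IH; congr (_ + _).
rewrite /precomp !comp_mpolyZ !comp_mpolyX; congr (_ *: _).
rewrite rmorph_prod; apply: eq_bigr => i _ /=; rewrite rmorphXn /=.
congr (_ ^+ _); rewrite !tnth_mktuple raddf_sum /=.
under [RHS]eq_bigr => k _ do
  rewrite comp_mpolyZ comp_mpolyXU -tnth_nth tnth_mktuple scaler_sumr.
rewrite exchange_big; apply: eq_bigr => j _ /=.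
by rewrite mxE scaler_suml; apply: eq_bigr => k _; rewrite scalerA.
Qed.

Definition ESP (r : nat) : {mpoly K[n]} := mesym n K r.

Variable r : nat.

Definition stabESP : {pred GLmx K n} := fun h => precomp (ESP r) h == ESP r.

Fact stabESP_group_closed : group_closed stabESP.
Proof.
split; first by apply/eqP/precomp1.
move=> g h /eqP gP /eqP hP; apply/eqP.
rewrite /= precompM gP -[X in precomp X]hP -precompM.
by rewrite mulmxV ?mxGL_unit // precomp1.
Qed.

Record stabESP_group :=
  MkStabESP { GL_of_stab :> GLmx K n; stabP : GL_of_stab \in stabESP }.
HB.instance Definition _ := [isSub for GL_of_stab].
HB.instance Definition _ := [Choice of stabESP_group by <:].
HB.instance Definition _ := SubChoice_isSubGroup.Build
  (GLmx K n) stabESP stabESP_group stabESP_group_closed.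

End Precomposition.

Section RootsOfUnity.
Variables (K : comUnitRingType) (r : nat).

(* Invertibility is only there to make this a group when r = 0; see mu_predE. *)
Definition mu_pred : pred K := fun w => (w \is a GRing.unit) && (w ^+ r == 1).

Lemma mu_predE w : (0 < r)%N -> mu_pred w = (w ^+ r == 1).
Proof.
rewrite /mu_pred => r0; case: eqP => [wr|]; last by rewrite andbF.
by rewrite andbT -(unitrX_pos _ r0) wr unitr1.
Qed.

Record mu := MkMu { root_of_mu : K; muP : mu_pred root_of_mu }.
HB.instance Definition _ := [isSub for root_of_mu].
HB.instance Definition _ := [Choice of mu by <:].

Fact mu_one_subproof : mu_pred 1.
Proof. by rewrite /mu_pred unitr1 expr1n eqxx. Qed.
Definition mu_one := MkMu mu_one_subproof.

Fact mu_mul_subproof (w z : mu) : mu_pred (root_of_mu w * root_of_mu z).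
Proof.
have [/andP[uw /eqP wr] /andP[uz /eqP zr]] := (muP w, muP z).
by rewrite /mu_pred unitrM uw uz exprMn wr zr mulr1 eqxx.
Qed.
Definition mu_mul w z := MkMu (mu_mul_subproof w z).

Fact mu_inv_subproof (w : mu) : mu_pred (root_of_mu w)^-1.
Proof.
have /andP[uw /eqP wr] := muP w.
by rewrite /mu_pred unitrV uw exprVn wr invr1 eqxx.
Qed.
Definition mu_inv w := MkMu (mu_inv_subproof w).

Fact mu_mulA : associative mu_mul.
Proof. by move=> x y z; apply/val_inj/mulrA. Qed.
Fact mu_mul1 : left_id mu_one mu_mul.
Proof. by move=> x; apply/val_inj/mul1r. Qed.
Fact mu_1mul : right_id mu_one mu_mul.
Proof. by move=> x; apply/val_inj/mulr1. Qed.
Fact mu_mulV : left_inverse mu_one mu_inv mu_mul.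
Proof. by move=> x; apply/val_inj/mulVr; case/andP: (muP x). Qed.
Fact mu_Vmul : right_inverse mu_one mu_inv mu_mul.
Proof. by move=> x; apply/val_inj/divrr; case/andP: (muP x). Qed.

HB.instance Definition _ := isGroup.Build mu
  mu_mulA mu_mul1 mu_1mul mu_mulV mu_Vmul.

End RootsOfUnity.

Section AutAction.
Local Open Scope group_scope.
Variables (N K : groupType).

Record autAction := AutAction {
  aut_act :> K -> N -> N;
  aut_act1 : forall x, aut_act 1 x = x;
  aut_actM : forall k l x, aut_act (k * l) x = aut_act k (aut_act l x);
  aut_actD : forall k x y, aut_act k (x * y) = (aut_act k x * aut_act k y)
}.

End AutAction.

(* The index theta selects the group law on N * K. *)
Record extsdprod (N K : groupType) (theta : autAction N K) :=
  SDPair { sd_left : N; sd_right : K }.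

Section ExternalSemidirectProduct.
Local Open Scope group_scope.
Variables (N K : groupType) (theta : autAction N K).
Local Notation extsdprod := (extsdprod theta).
Local Notation SDPair := (SDPair theta).

Fact aut_act_one k : theta k 1 = 1.
Proof. by apply: (mulgI (theta k 1)); rewrite -aut_actD !mulg1. Qed.

Definition sd_to_pair (u : extsdprod) := (sd_left u, sd_right u).
Definition sd_of_pair (u : (N * K)%type) := SDPair u.1 u.2.
Fact sd_to_pairK : cancel sd_to_pair sd_of_pair.
Proof. by case. Qed.
HB.instance Definition _ := Choice.copy extsdprod (can_type sd_to_pairK).

Definition sd_one := SDPair 1 1.
Definition sd_mul (u v : extsdprod) :=
  SDPair (sd_left u * theta (sd_right u) (sd_left v)) (sd_right u * sd_right v).
Definition sd_inv (u : extsdprod) :=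
  SDPair (theta (sd_right u)^-1 (sd_left u)^-1) (sd_right u)^-1.

Fact sd_mulA : associative sd_mul.
Proof.
by move=> [x k] [y l] [z m]; rewrite /sd_mul /= aut_actD aut_actM !mulgA.
Qed.
Fact sd_mul1 : left_id sd_one sd_mul.
Proof. by case=> x k; rewrite /sd_mul /= aut_act1 !mul1g. Qed.
Fact sd_1mul : right_id sd_one sd_mul.
Proof. by case=> x k; rewrite /sd_mul /= aut_act_one !mulg1. Qed.
Fact sd_mulV : left_inverse sd_one sd_inv sd_mul.
Proof.
by case=> x k; rewrite /sd_mul /= -aut_actD !mulVg aut_act_one.
Qed.
Fact sd_Vmul : right_inverse sd_one sd_inv sd_mul.
Proof.
by case=> x k; rewrite /sd_mul /= -aut_actM !mulgV aut_act1 mulgV.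
Qed.

HB.instance Definition _ := isGroup.Build extsdprod
  sd_mulA sd_mul1 sd_1mul sd_mulV sd_Vmul.

End ExternalSemidirectProduct.

(* Main.v *)
Require Import Defs.
From HB Require Import structures.
From mathcomp Require Import all_boot all_order all_algebra all_fingroup.
From mathcomp Require Import reals complex mpoly.
From mathcomp Require Import zify ring.

Set Implicit Arguments.
Unset Strict Implicit.
Unset Printing Implicit Defensive.

Import GRing.Theory Num.Theory.
Local Open Scope ring_scope.

(* Let h stabilize e_r, and let v be a column of h. Since e_r is affine in each
   variable, e_r(b + t e_j) is affine in t, hence so is e_r(y + t v) for every
   y. Taking y to be the indicator vector of a set S of size r - 2, the
   coefficient of t^2 is e_2 of the entries of v outside S, which therefore
   vanishes. As 2 < r < n, the complements of such S have size between 3 and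
   n - 1, and e_2 vanishing on all subsets of such a size forces v to have at
   most one nonzero entry. So h is monomial; comparing the coefficients of e_r,
   the product of any r of its nonzero entries is 1, whence (r < n) they are
   all equal to a common r-th root of unity. Scalars being central, the action
   defining the semidirect product is trivial. *)

(** * Finite sets and the second elementary symmetric sum *)

Lemma ex_set_between (T : finType) (A B : {set T}) (k : nat) :
  A \subset B -> (#|A| <= k <= #|B|)%N ->
  exists C : {set T}, [/\ A \subset C, C \subset B & #|C| = k].
Proof.
move=> sAB /andP[leAk lekB].
have : (k - #|A| <= #|B :\: A|)%N by rewrite cardsDS // leq_sub2r.
case/card_geqP => s [us ss /subsetP sBA].
have dAs : [disjoint A & [set x in s]].
  rewrite -setI_eq0; apply/eqP/setP => x; rewrite !inE.
  by apply/negP => /andP[xA /(subsetP sBA)]; rewrite inE xA.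
exists (A :|: [set x in s]); split; first exact: subsetUl.
  rewrite subUset sAB; apply/subsetP => x; rewrite inE.
  by move=> /(subsetP sBA); rewrite inE => /andP[].
by rewrite cardsU (disjoint_setI0 dAs) cards0 cardsE (card_uniqP us) ss; lia.
Qed.

(** Newton's identity 2 e_2 = p_1^2 - p_2: off the diagonal, each pair {a, b} comes from both (a, b)
    and (b, a). *)
Lemma sum_pairs_mul2n (R : comNzRingType) (I : finType) (w : I -> R)
    (T : {set I}) :
  (\sum_(J : {set I} | (J \subset T) && (#|J| == 2)) \prod_(i in J) w i) *+ 2
  = (\sum_(i in T) w i) ^+ 2 - \sum_(i in T) w i ^+ 2.
Proof.
rewrite expr2 big_distrlr /= pair_big /=.
rewrite (bigID (fun p => p.1 == p.2)) /=.
have -> : \sum_(p | (p.1 \in T) && (p.2 \in T) && (p.1 == p.2)) w p.1 * w p.2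
    = \sum_(i in T) w i ^+ 2.
  rewrite (reindex_onto (fun i => (i, i)) fst) /=; last first.
    by case=> i j /= /andP[_ /eqP->].
  by apply: eq_bigl => i; rewrite !eqxx !andbT andbb.
rewrite [RHS]addrC addKr.
rewrite (partition_big (fun p => [set p.1; p.2])
  (fun J : {set I} => (J \subset T) && (#|J| == 2))) /=; last first.
  case=> i j /= /andP[/andP[iT jT] ij].
  by rewrite cards2 ij eqxx andbT subUset !sub1set iT.
rewrite -sumrMnl; apply: eq_bigr => J /andP[JT /cards2P[a [b [ab JE]]]]; subst J.
move: JT; rewrite subUset !sub1set => /andP[aT bT].
rewrite (bigD1 (a, b)) /=; last by rewrite aT bT ab eqxx.
rewrite (bigD1 (b, a)) /=; last first.
  by rewrite aT bT eq_sym ab setUC eqxx xpair_eqE negb_and ab orbT.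
rewrite big_setU1 ?inE //= big_set1 big1 ?addr0; last first.
  case=> i j /= /andP[/andP[/andP[/andP[_ ij] /eqP E] ab'] ba'].
  have: i \in [set a; b] by rewrite -E !inE eqxx.
  have: j \in [set a; b] by rewrite -E !inE eqxx orbT.
  rewrite !inE => /orP[]/eqP ej /orP[]/eqP ei; subst i j.
  - by rewrite eqxx in ij.
  - by rewrite eqxx in ba'.
  - by rewrite eqxx in ab'.
  - by rewrite eqxx in ij.
by rewrite mulr2n [w b * _]mulrC.
Qed.

(** Let s and q be the sums of the [w k] and of their squares over [U]. Deleting [k] gives (s - w
    k)^2 = q - (w k)^2; these relations add up to (|U| - 2)(s^2 - q) = 0, so s^2 = q and every
    nonzero [w k] equals s. *)
Lemma sum_pairs_eq0 (K : numFieldType) (I : finType) (w : I -> K) (U : {set I})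
    (i j : I) :
    (3 < #|U|)%N -> i \in U -> j \in U -> i != j ->
    (forall k, k \in U ->
      \sum_(J : {set I} | (J \subset U :\ k) && (#|J| == 2))
         \prod_(l in J) w l = 0) ->
  w i * w j = 0.
Proof.
move=> U3 iU jU ij w0.
have [s sE] : exists s, \sum_(k in U) w k = s by eexists.
have [q qE] : exists q, \sum_(k in U) w k ^+ 2 = q by eexists.
have wk k : k \in U -> (s - w k) ^+ 2 = q - w k ^+ 2.
  move=> kU; have := sum_pairs_mul2n w (U :\ k); rewrite w0 // mul0rn.
  move/esym/subr0_eq; rewrite -sE -qE !(big_setD1 k kU) /=.
  by rewrite ![w k + _]addrC addrK [w k ^+ 2 + _]addrC addrK.
(* Sum the relations wk over U. *)
have sq : s ^+ 2 = q.
  have : \sum_(k in U) ((s - w k) ^+ 2 - (q - w k ^+ 2)) = 0.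
    by apply: big1 => k /wk->; rewrite subrr.
  have -> : \sum_(k in U) ((s - w k) ^+ 2 - (q - w k ^+ 2))
      = \sum_(k in U) (s ^+ 2 - q) + (- (s *+ 2) * s + q *+ 2).
    rewrite -[X in _ * X + _]sE -[X in _ + X *+ 2]qE mulr_sumr -sumrMnl.
    by rewrite -!big_split /=; apply: eq_bigr => k _; ring.
  rewrite sumr_const => e; apply/subr0_eq/eqP.
  have : (s ^+ 2 - q) *+ (#|U| - 2) = 0.
    rewrite mulrnBr; last by lia.
    by apply: etrans e; ring.
  by move/eqP; rewrite mulrn_eq0 => /orP[/eqP|//]; lia.
have w0s k : k \in U -> w k != 0 -> w k = s.
  move=> /wk; rewrite -sq => e nz; apply: (mulfI nz).
  apply: (mulfI (_ : 2 != 0 :> K)); first by rewrite pnatr_eq0.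
  apply: subr0_eq; rewrite -[RHS](subrr (s ^+ 2 - w k ^+ 2)) -{1}e; ring.
apply/eqP; rewrite mulf_eq0; apply: contraT; rewrite negb_or => /andP[wi wj].
have s0 : s != 0 by rewrite -(w0s i).
(* If m entries are nonzero then s = m s, so m = 1 in characteristic zero, against [i] and [j] being
   distinct. *)
have : s = s *+ #|[set k in U | w k != 0]|.
  rewrite -sumr_const -{1}sE (bigID (fun k => w k == 0)) /= big1 ?add0r.
    by apply: eq_big => [k|k /andP[kU /w0s->//]]; rewrite inE.
  by move=> k /andP[_ /eqP].
rewrite -{1}[s]mulr1n => /(mulrIn s0) /esym/eqP/cards1P[x e].
have : i \in [set x] by rewrite -e inE iU.
have : j \in [set x] by rewrite -e inE jU.
by rewrite !inE => /eqP jx /eqP ix; rewrite ix jx eqxx in ij.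
Qed.

(** * Coefficients and values of polynomials in one variable *)

(** Factors in [S] have constant term 1, those outside are multiples of X. So the product over A is
    divisible by X to the power |A \ S|, which is at least r - |S| = 2, and only the sets A = J + S
    with J a pair outside [S] contribute. *)
Lemma coef2_sum_prod (R : comNzRingType) (I : finType) (w : I -> R)
    (S : {set I}) (r : nat) : #|S|.+2 = r ->
  (\sum_(A : {set I} | #|A| == r)
     \prod_(i in A) ((i \in S)%:R%:P + w i *: 'X))`_2
  = \sum_(J : {set I} | (J \subset ~: S) && (#|J| == 2)) \prod_(i in J) w i.
Proof.
move=> Sr; rewrite coef_sum.
transitivity (\sum_(A : {set I} | (#|A| == r) && (#|A :\: S| == 2))
    \prod_(i in A :\: S) w i).
  rewrite [RHS]big_mkcondr /=; apply: eq_bigr => A /eqP Ar.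
  rewrite (bigID (mem S)) /=.
  have -> : \prod_(i in A | i \notin S) ((i \in S)%:R%:P + w i *: 'X)
     = (\prod_(i in A :\: S) w i) *: 'X^#|A :\: S|.
    rewrite -prodr_const -scaler_prod.
    apply: eq_big => [i|i /andP[_ /negPf->]]; first by rewrite inE andbC.
    by rewrite polyC0 add0r.
  rewrite -scalerAr coefZ coefMXn.
  have := cardsID S A; have := subset_leq_card (subsetIr A S).
  case: ltngtP => [| |<-]; [by rewrite mulr0|lia|move=> _ _].
  rewrite subnn coef0_prod [X in _ * X]big1 ?mulr1 // => i /andP[_ /= ->].
  by rewrite coefD coefC coefZ coefX mulr0 addr0.
have uA (A : {set I}) : #|A| = r -> #|A :\: S| = 2 -> A :\: S :|: S = A.
  move=> Ar AS; have /subsetP SA : S \subset A.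
    by apply/setIidPr/eqP; rewrite eqEcard subsetIr; have := cardsID S A; lia.
  apply/setP => x; rewrite !inE orbC.
  by have [/SA->|] := boolP (x \in S).
rewrite (reindex_onto (fun J => J :|: S) (fun A => A :\: S)) /=; last first.
  by move=> A /andP[/eqP Ar /eqP AS]; apply: uA.
apply: eq_big => [J|J /andP[_ /eqP->]//].
rewrite setDUl setDv setU0.
have -> : (J :\: S == J) = (J \subset ~: S) by rewrite setDE (sameP eqP setIidPl).
have [JS|_] := boolP (J \subset ~: S); last by rewrite andbF.
have dJS : J :&: S = set0 by apply/eqP; rewrite setI_eq0 disjoints_subset.
have -> : J :\: S = J by rewrite setDE; apply/setIidPl.
by rewrite andbT cardsU dJS cards0 -Sr subn0 -(addn2 #|S|) addnC eqn_add2l andbb.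
Qed.
(** The difference vanishes at as many natural numbers as its size, and these are distinct in
    characteristic zero. *)
Lemma eq_poly_horner (K : numDomainType) (p q : {poly K}) :
  (forall t, p.[t] = q.[t]) -> p = q.
Proof.
move=> pq; apply/subr0_eq/(@roots_geq_poly_eq0 _ _
  [seq k%:R | k <- iota 0 (size (p - q))]).
- by apply/allP => t _; rewrite rootE hornerD hornerN pq subrr.
- by rewrite map_inj_uniq ?iota_uniq // => a b /eqP; rewrite eqr_nat => /eqP.
- by rewrite size_map size_iota.
Qed.

(** * Columns of a stabilizing matrix *)

Section Stabilizer.
Variables (K : numFieldType) (n : nat).
Implicit Types (A : 'M[K]_n) (x : 'I_n -> K) (r : nat).

Lemma meval_ESP r x :
  (ESP K n r).@[x] = \sum_(I : {set 'I_n} | #|I| == r) \prod_(i in I) x i.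
Proof.
rewrite /ESP /mesym raddf_sum /=; apply: eq_bigr => I _.
by rewrite rmorph_prod /=; apply: eq_bigr => i _; rewrite mevalXU.
Qed.

Lemma precomp_ESP_mulmx r A (y : 'cV[K]_n) : precomp (ESP K n r) A = ESP K n r ->
  (ESP K n r).@[fun i => (A *m y) i 0] = (ESP K n r).@[fun i => y i 0].
Proof. by move=> AP; rewrite -meval_precomp AP. Qed.

Lemma stab_col_pairs r A (j : 'I_n) (S : {set 'I_n}) :
    A \in unitmx -> precomp (ESP K n r) A = ESP K n r -> #|S|.+2 = r ->
  \sum_(J : {set 'I_n} | (J \subset ~: S) && (#|J| == 2)) \prod_(i in J) A i j
  = 0.
Proof.
move=> uA AP Sr; rewrite -(coef2_sum_prod _ Sr).
(* [b] is the preimage of the indicator of [S], so b + t e_j is sent to that indicator plus t times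
   column [j] of [A]. *)
pose b := invmx A *m \col_i (i \in S)%:R.
have -> : \sum_(I : {set 'I_n} | #|I| == r)
      \prod_(i in I) ((i \in S)%:R%:P + A i j *: 'X)
    = \sum_(I : {set 'I_n} | #|I| == r)
      \prod_(i in I) ((b i 0)%:P + (i == j)%:R *: 'X).
  apply: eq_poly_horner => t; rewrite !horner_sum.
  have := precomp_ESP_mulmx (b + t *: delta_mx j 0) AP.
  rewrite mulmxDr mulKVmx // -scalemxAr -colE !meval_ESP => e.
  apply: etrans (etrans e _); apply: eq_bigr => I _; rewrite horner_prod;
    apply: eq_bigr => i _; rewrite !mxE hornerD hornerC hornerZ hornerX //.
    by rewrite mulrC.
  by rewrite andbT mulrC.
(* Only the factor at [j] involves X, so every product has degree at most 1. *)
rewrite coef_sum big1 // => I _.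
have [jI|jI] := boolP (j \in I).
  rewrite (bigD1 j) //= (eq_bigr (fun i => (b i 0)%:P)); last first.
    by move=> i /andP[_ /negPf->]; rewrite scale0r addr0.
  rewrite -rmorph_prod /= coefMC coefD coefC coefZ coefX /= mulr0 addr0.
  by rewrite mul0r.
rewrite (eq_bigr (fun i => (b i 0)%:P)) -?rmorph_prod ?coefC //= => i iI.
by case: eqP iI jI => [->->|_ _ _] //; rewrite scale0r addr0.
Qed.

Lemma stab_col r A (i i' j : 'I_n) : (2 < r < n)%N ->
    A \in unitmx -> precomp (ESP K n r) A = ESP K n r -> i != i' ->
  A i j * A i' j = 0.
Proof.
move=> /andP[r2 rn] uA AP ii'.
(* The size n - r + 3 is at least 4 since r < n and at most n since 2 < r; dropping one point leaves
   a complement of size r - 2. *)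
have [|U [sU _ cU]] :=
    @ex_set_between _ [set i; i'] [set: 'I_n] (n - r + 3) (subsetT _).
  by rewrite cards2 ii' cardsT card_ord; lia.
move: sU; rewrite subUset !sub1set => /andP[iU i'U].
apply: (@sum_pairs_eq0 _ _ (fun k => A k j) U); rewrite ?cU //; first by lia.
move=> k kU; rewrite -[U :\ k]setCK.
apply: (@stab_col_pairs r) => //.
have := cardsC (U :\ k); have := cardsD1 k U.
by rewrite kU cU card_ord add1n; move: #|U :\ k| #|~: _| => a b; lia.
Qed.

(** Columns have at most one nonzero entry and rows, by invertibility, at least one. Choosing one in
    each row is thus injective, hence onto, which leaves no room for others. *)
Lemma stab_monomial r A : (2 < r < n)%N ->
    A \in unitmx -> precomp (ESP K n r) A = ESP K n r ->
  exists (s : 'S_n) (d : 'I_n -> K), A = \matrix_(i, j) (d i *+ (s i == j)).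
Proof.
move=> rn uA AP.
have colA i i' j : A i j != 0 -> A i' j != 0 -> i = i'.
  move=> nz nz'; apply/eqP; apply: contraT => /(stab_col j rn uA AP)/eqP.
  by rewrite mulf_eq0 (negPf nz) (negPf nz').
have rowA i : exists j, A i j != 0.
  apply/existsP; apply: contraT => /existsPn z.
  have : row i A *m invmx A = 0.
    rewrite (_ : row i A = 0) ?mul0mx //.
    by apply/rowP => j; rewrite !mxE; apply/eqP/negPn/z.
  rewrite -row_mul mulmxV // => /rowP/(_ i); rewrite !mxE eqxx => /eqP.
  by rewrite oner_eq0.
have [f fP] : exists f : 'I_n -> 'I_n, forall i, A i (f i) != 0.
  by exists (fun i => xchoose (rowA i)) => i; exact: (xchooseP (rowA i)).
have f_inj : injective f.
  by move=> i i' e; apply: (colA _ _ _ (fP i)); rewrite e.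
exists (perm f_inj), (fun i => A i (f i)); apply/matrixP => i j.
rewrite mxE permE; have [<-//|ne] := eqVneq; rewrite mulr0n.
apply/eqP; apply: contraT => nz.
have /codomP[i' e] : j \in codom f by exact: inj_card_onto.
by rewrite e in ne nz; rewrite (colA _ _ _ nz (fP i')) eqxx in ne.
Qed.

(** * From monomial matrices to scaled permutation matrices *)

Lemma ESP_supp (I : {set 'I_n}) x : (forall i, i \notin I -> x i = 0) ->
  (ESP K n #|I|).@[x] = \prod_(i in I) x i.
Proof.
move=> x0; rewrite meval_ESP (bigD1 I) //= [X in _ + X]big1 ?addr0 // => J /andP[/eqP JI nJ].
have /subsetPn[i iJ iI] : ~~ (J \subset I).
  by apply: contra nJ => sJI; rewrite eqEcard sJI JI leqnn.
by rewrite (bigD1 i) //= x0 ?mul0r.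
Qed.

Lemma stab_monomial_prod (s : 'S_n) (d : 'I_n -> K) (I : {set 'I_n}) :
    precomp (ESP K n #|I|) (\matrix_(i, j) (d i *+ (s i == j)))
    = ESP K n #|I| ->
  \prod_(i in I) d i = 1.
Proof.
(* The image of the indicator of s(I) is supported on [I] with entries [d i], so comparing values of
   [ESP] equates their product with 1. *)
move=> AP; pose y : 'cV[K]_n := \col_j (j \in s @: I)%:R.
have := precomp_ESP_mulmx y AP.
rewrite (@ESP_supp I); last first.
  move=> i iI; rewrite mxE big1 // => j _; rewrite !mxE.
  have [<-|_] := eqVneq; last by rewrite mul0r.
  by rewrite mem_imset ?(negPf iI) ?mulr0 //; apply: perm_inj.
rewrite -(card_imset I (@perm_inj _ s)) ESP_supp; last first.
  by move=> i iI; rewrite mxE (negPf iI).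
rewrite [RHS]big1 => [e|j jI]; last by rewrite mxE jI.
rewrite -[RHS]e; apply: eq_bigr => i iI; rewrite mxE (bigD1 (s i)) //=.
rewrite !mxE eqxx mem_imset ?iI ?mulr1; last exact: perm_inj.
by rewrite big1 ?addr0 // => j; rewrite !mxE eq_sym => /negPf->; rewrite mul0r.
Qed.

Lemma stab_scaled_perm r A : (2 < r < n)%N ->
    A \in unitmx -> precomp (ESP K n r) A = ESP K n r ->
  exists (s : 'S_n) (w : K), w ^+ r = 1 /\ A = w *: perm_mx s.
Proof.
move=> rn uA AP; have [s [d Ad]] := stab_monomial rn uA AP.
have dP (I : {set 'I_n}) : #|I| = r -> \prod_(i in I) d i = 1.
  by move=> Ir; apply: (@stab_monomial_prod s); rewrite Ir -Ad.
have dE i j : d i = d j.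
  have [->//|ij] := eqVneq i j.
  (* Since r < n, there are r - 1 indices avoiding [i] and [j]; adjoining either one gives product
     1, and the common factor cancels. *)
  have [|I [_ sI cI]] := @ex_set_between _ set0 (~: [set i; j]) r.-1 (sub0set _).
    rewrite cards0 /=; have := cardsC [set i; j]; rewrite cards2 ij card_ord.
    by move: #|~: _| => m; lia.
  have iI : i \notin I by apply/negP => /(subsetP sI); rewrite !inE eqxx.
  have jI : j \notin I by apply/negP => /(subsetP sI); rewrite !inE eqxx orbT.
  have := dP (i |: I); have := dP (j |: I).
  rewrite !cardsU1 iI jI !big_setU1 //= cI.
  have r1 : (1 + r.-1)%N = r by lia.
  move=> /(_ r1) dj /(_ r1) di.
  have nz : \prod_(k in I) d k != 0.
    by apply: contra_eq_neq dj => ->; rewrite mulr0 eq_sym oner_eq0.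
  by apply: (mulIf nz); rewrite di dj.
have n0 : (0 < n)%N by lia.
exists s, (d (Ordinal n0)); split; last first.
  rewrite Ad; apply/matrixP => i j; rewrite !mxE (dE i (Ordinal n0)).
  by rewrite mulr_natr.
have [|I [_ _ cI]] := @ex_set_between _ set0 [set: 'I_n] r (sub0set _).
  by rewrite cards0 cardsT card_ord; lia.
rewrite -(dP I cI) -cI -prodr_const.
by apply: eq_bigr => i _.
Qed.

Lemma scaled_perm_stab r (s : 'S_n) (w : K) : w ^+ r = 1 ->
  precomp (ESP K n r) (w *: perm_mx s) = ESP K n r.
Proof.
move=> wr; rewrite /precomp /ESP /mesym raddf_sum /=.
(* The substitution sends X_i to w X_(s i), so the monomial of s^-1(I) becomes w^r times that of
   [I]. *)
rewrite (reindex_inj (imset_inj (@perm_inj _ s^-1))) /=.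
apply: eq_big => [I|I]; first by rewrite card_imset //; apply: perm_inj.
rewrite card_imset; last exact: perm_inj.
move=> /eqP Ir; rewrite rmorph_prod /=.
rewrite big_imset /=; last by move=> ? ? _ _; apply: perm_inj.
rewrite (eq_bigr (fun i => w *: 'X_i)) => [|i _].
  by rewrite scaler_prod prodr_const Ir wr scale1r.
rewrite comp_mpolyXU -tnth_nth tnth_mktuple (bigD1 i) //= big1 ?addr0.
  by rewrite !mxE permKV eqxx mulr1.
by move=> j; rewrite !mxE permKV eq_sym => /negPf->; rewrite mulr0 scale0r.
Qed.

End Stabilizer.

(** * The isomorphism with the semidirect product *)

Section Isomorphism.
Variables (K : numFieldType) (n r : nat).

Definition trivial_act : autAction 'S_n (mu K r) :=
  @AutAction 'S_n (mu K r) (fun _ s => s) (fun _ => erefl) (fun _ _ _ => erefl)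
    (fun _ _ _ => erefl).

Fact scaled_perm_unit (u : extsdprod trivial_act) :
  root_of_mu (sd_right u) *: perm_mx (sd_left u) \in unitmx.
Proof.
by rewrite unitmxZ ?unitmx_perm //; case/andP: (muP (sd_right u)).
Qed.

Fact scaled_perm_in_stab (u : extsdprod trivial_act) :
  MkGLmx (scaled_perm_unit u) \in stabESP (K := K) (n := n) r.
Proof.
by apply/eqP/scaled_perm_stab/eqP; case/andP: (muP (sd_right u)).
Qed.

Definition scaled_perm (u : extsdprod trivial_act) : stabESP_group K n r :=
  MkStabESP (scaled_perm_in_stab u).

(** The product [s * t] applies [s] first, and row i of [perm_mx s] has its 1 in column s i, so
    [perm_mx] does not reverse products. *)
Fact scaled_permM : {morph scaled_perm : u v / (u * v)%g}.
Proof.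
move=> [s w] [t z]; apply: val_inj; apply: val_inj; rewrite /= perm_mxM.
by rewrite -scalemxAl -scalemxAr scalerA.
Qed.

HB.instance Definition _ := isMultiplicative.Build
  (extsdprod trivial_act) (stabESP_group K n r) scaled_perm scaled_permM.

Lemma scaled_perm_inj (w w' : K) (s s' : 'S_n) : (0 < n)%N -> w != 0 ->
  w *: perm_mx s = w' *: perm_mx s' -> w = w' /\ s = s'.
Proof.
move=> n0 w0 /matrixP e.
(* The left side has entry [w] at (i, s i), where the right side would vanish if s' i differed from
   s i. *)
have ss i : s' i = s i.
  have /eqP := e i (s i); rewrite !mxE eqxx mulr1.
  by case: (s' i =P s i) => // _; rewrite mulr0 (negPf w0).
split; last by apply/permP.
by have := e (Ordinal n0) (s (Ordinal n0)); rewrite !mxE ss eqxx !mulr1.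
Qed.

Lemma scaled_perm_bij : (2 < r < n)%N -> bijective scaled_perm.
Proof.
move=> rn; have [n0 r0] : (0 < n)%N /\ (0 < r)%N by lia.
have surj (h : stabESP_group K n r) : exists u, scaled_perm u == h.
  have [s [w [wr hE]]] :=
    stab_scaled_perm rn (mxGL_unit h) (eqP (stabP h)).
  have wP : mu_pred r w by rewrite mu_predE // wr.
  by exists (SDPair trivial_act s (MkMu wP)); apply/eqP; apply: val_inj; apply: val_inj.
(* The inverse chooses a preimage; injectivity shows that it recovers the original pair. *)
exists (fun h => xchoose (surj h)) => [u|h]; last exact/eqP/(xchooseP (surj h)).
have /eqP := xchooseP (surj (scaled_perm u)).
case: (xchoose _) => s w; case: u => t z /(congr1 (val \o val)) /= e.
have /andP[uw _] := muP w.
have [|wz ->] := scaled_perm_inj n0 _ e; last by congr SDPair; apply: val_inj.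
by rewrite -unitfE.
Qed.

End Isomorphism.

Theorem theorem1 (R : realType) (n r : nat) (hr : (2 < r < n)%N) :
  [/\ exists (theta : autAction 'S_n (mu R[i] r))
             (f : {multiplicative extsdprod theta -> stabESP_group R[i] n r}),
        [/\ bijective f,
            forall s : 'S_n, mxGL (f (SDPair theta s 1%g)) = perm_mx s
          & forall w : mu R[i] r, mxGL (f (SDPair theta 1%g w)) = (root_of_mu w)%:M],
      forall A : 'M[R[i]]_n,
        (exists2 h : GLmx R[i] n, h \in stabESP r & mxGL h = A) <->
        (exists (w : R[i]) (P : 'M[R[i]]_n),
           [/\ w ^+ r = 1, is_perm_mx P & A = w *: P])
    & forall (w w' : R[i]) (P P' : 'M[R[i]]_n),
        w ^+ r = 1 -> is_perm_mx P -> w' ^+ r = 1 -> is_perm_mx P' ->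
        w *: P = w' *: P' -> w = w' /\ P = P'].
Proof.
have [n0 r0] : (0 < n)%N /\ (0 < r)%N by lia.
split.
- exists (@trivial_act R[i] n r), (@scaled_perm R[i] n r); split=> [|s|w] /=.
  + exact: scaled_perm_bij.
  + by rewrite scale1r.
  + by rewrite perm_mx1 scalemx1.
- move=> A; split.
    case=> h /eqP hP <-.
    have [s [w [wr hE]]] := stab_scaled_perm hr (mxGL_unit h) hP.
    by exists w, (perm_mx s); split=> //; apply: perm_mx_is_perm.
  case=> w [P [wr /is_perm_mxP[s ->] ->]].
  have wP : mu_pred r w by rewrite mu_predE // wr.
  pose u := SDPair (@trivial_act R[i] n r) s (MkMu wP).
  by exists (MkGLmx (scaled_perm_unit u)); first exact: scaled_perm_in_stab.
- move=> w w' _ _ wr /is_perm_mxP[s ->] _ /is_perm_mxP[s' ->] e.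
  have [|-> ->//] := scaled_perm_inj n0 _ e.
  (* [w] is nonzero because its r-th power is 1 and r > 0. *)
  by apply: contra_eq_neq wr => ->; rewrite expr0n eqn0Ngt r0 eq_sym oner_eq0.
Qed.
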